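(* Let $X\sim\mu_X$ be a random variable in $\mathbb{R}^d$, let $\mathcal{M}$ be a set of probability measures on a measurable space $\mathcal{Z}$, and let $f:\mathbb{R}^d\times\mathcal{Z}\to\mathbb{R}$ be a measurable function that for each $\mu\in\mathcal{M}$ has a finite $L^p(\mu_X\times\mu)$ norm for some $p\ge1$. For $\mu\in\mathcal{M}$ let $$F_\mu(x)=\operatorname{med}_{Z\sim\mu}\left(f(x,Z)\right)$$ denote the median of $f(x,Z)$ with respect to $Z\sim\mu$. Then, for any reference measure $\mu_{\mathrm{ref}}\in\mathcal{M}$ and any $\alpha>1$, $$\mathbb{E}_{\mu_X}\left(\sup_{\mu\in\mathcal{M}:\,\mu\ll\mu_{\mathrm{ref}}}F_\mu(X)\right)\le\inf_{p\ge1}\left(\left(\mathbb{E}_{\mu_X\times\mu_{\mathrm{ref}}}\left((f(X,Z))_+^p\right)\right)^{1/p}\sup_{\mu\in\mathcal{M}:\,\mu\ll\mu_{\mathrm{ref}}}e^{\hat D_{\alpha,\mathrm{KL}}(\mu,\mu_{\mathrm{ref}})/p}\right),$$ where $$\hat D_{\alpha,\mathrm{KL}}(\mu,\mu_{\mathrm{ref}})=\min\left\{D_\alpha(\mu,\mu_{\mathrm{ref}})+\frac{\alpha}{\alpha-1}\log 2,\ 2D_{\mathrm{KL}}(\mu,\mu_{\mathrm{ref}})+2\log 2\right\}.$$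
   Context: $(z)_+=\max\{z,0\}$ and $(z)_+^p=((z)_+)^p$. For probability measures $\mu\ll\mu_{\mathrm{ref}}$, the Rényi divergence of order $\alpha>1$ is $D_\alpha(\mu,\mu_{\mathrm{ref}})=\frac{1}{\alpha-1}\log\mathbb{E}_{\mu_{\mathrm{ref}}}\left(\left(\frac{d\mu}{d\mu_{\mathrm{ref}}}\right)^\alpha\right)\in[0,\infty]$, and the Kullback–Leibler divergence is $D_{\mathrm{KL}}(\mu,\mu_{\mathrm{ref}})=\mathbb{E}_\mu\left(\log\frac{d\mu}{d\mu_{\mathrm{ref}}}\right)\in[0,\infty]$. A median of a real random variable $W$ is a number $m$ with $\mathbb{P}(W\ge m)\ge1/2$ and $\mathbb{P}(W\le m)\ge1/2$; if it is not unique, $F_\mu(x)$ is any fixed choice. The functions $F_\mu$ and the supremum inside the expectation on the left are assumed measurable. Quantities on the right take values in $[0,\infty]$ with $0\cdot\infty=\infty$. *)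

(* Defs.v *)
From HB Require Import structures.
From mathcomp Require Import all_boot all_order all_algebra.
From mathcomp Require Import all_classical all_reals all_analysis measurable_realfun.

Set Implicit Arguments.
Unset Strict Implicit.
Unset Printing Implicit Defensive.

Import Order.TTheory GRing.Theory Num.Theory.
Import numFieldNormedType.Exports.

Local Open Scope classical_set_scope.
Local Open Scope ring_scope.
Local Open Scope ereal_scope.
Local Open Scope charge_scope.

(* The measurable structure on tuples is generated by the coordinates, so this
   is R^d with its Borel sigma-algebra. *)
Notation euclidean R d := (d.-tuple (measurableTypeR R)).

Definition is_median {dT : measure_display} {T : measurableType dT}
    {R : realType} (P : probability T R) (W : T -> R) (m : R) : Prop :=
  (2^-1)%:E <= P [set z | (m <= W z)%R] /\
  (2^-1)%:E <= P [set z | (W z <= m)%R].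

(* The library derivative is a version of dmu/dnu only when mu `<< nu; the
   divergences below are used only in that case. *)
Definition density {dT : measure_display} {T : measurableType dT}
    {R : realType} (mu nu : probability T R) : T -> \bar R :=
  'd (charge_of_finite_measure mu) '/d nu.

Definition renyi_div {dT : measure_display} {T : measurableType dT}
    {R : realType} (alpha : R) (mu nu : probability T R) : \bar R :=
  ((alpha - 1)^-1)%:E * lne (\int[nu]_z (density mu nu z `^ alpha)).

Definition kl_div {dT : measure_display} {T : measurableType dT}
    {R : realType} (mu nu : probability T R) : \bar R :=
  \int[mu]_z lne (density mu nu z).

Definition renyi_kl_bound {dT : measure_display} {T : measurableType dT}
    {R : realType} (alpha : R) (mu nu : probability T R) : \bar R :=
  Order.min
    (renyi_div alpha mu nu + (alpha / (alpha - 1) * ln 2)%:E)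
    (2%:E * kl_div mu nu + (2 * ln 2)%:E).

(* Multiplication on [0, +oo] with 0 * +oo = +oo, whereas the library's
   multiplication has 0 * +oo = 0. *)
Definition mul_infty {R : realType} (x y : \bar R) : \bar R :=
  if (x == +oo) || (y == +oo) then +oo else x * y.

(* Main.v *)
(* If mu(A) >= 1/2, then nu(A) >= exp (- D) where D is either of the two
   quantities in the minimum.  With density k and r = nu(A), both cases follow
   by integrating a tangent-line inequality: that of x^alpha at 1/(2r) over A
   for the Renyi divergence, that of log for the Kullback-Leibler divergence.
   Apply this to A = {z | f(x, z) >= F_mu(x)}: Markov's inequality bounds
   F_mu(x)^p by exp D times the integral of f(x, .)_+^p against mu_ref.  This
   bound is uniform in mu up to the supremum of exp D, and Jensen and Tonelli
   integrate its p-th root over x. *)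
Require Import Defs.
From HB Require Import structures.
From mathcomp Require Import all_boot all_order all_algebra.
From mathcomp Require Import all_classical all_reals all_analysis measurable_realfun.
From mathcomp Require Import ring lra.

Set Implicit Arguments.
Unset Strict Implicit.
Unset Printing Implicit Defensive.

Import Order.TTheory GRing.Theory Num.Theory.
Import numFieldNormedType.Exports.

Local Open Scope classical_set_scope.
Local Open Scope ring_scope.
Local Open Scope ereal_scope.

(** * Tangent-line inequalities for powers and the logarithm *)

Lemma powR_tangent (R : realType) (p a t : R) : (1 <= p)%R -> (0 <= a)%R ->
  (0 < t)%R -> (p * t `^ (p - 1) * a <= a `^ p + (p - 1) * t `^ p)%R.
Proof.
rewrite le_eqVlt => /predU1P[<- a0 t0|p1 a0 t0].
  by rewrite subrr powRr0 mul0r addr0 !mul1r powRr1.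
have p0 : (0 < p)%R by lra.
have p10 : (0 < p - 1)%R by lra.
(* Young's inequality for [a] and [t^(p-1)] with exponents [p] and [p/(p-1)], multiplied by [p], is
   the tangent bound. The second exponent needs [p > 1], hence the separate case [p = 1]. *)
have pq : (p^-1 + (p / (p - 1))^-1 = 1)%R by field; rewrite !gt_eqF.
have := conjugate_powR a0 (powR_ge0 t (p - 1)) p0 (divr_gt0 p0 p10) pq.
have -> : ((t `^ (p - 1)) `^ (p / (p - 1)) = t `^ p)%R.
  by rewrite -powRrM; congr (_ `^ _)%R; field; rewrite gt_eqF.
rewrite -(ler_pM2l p0) => H; apply: le_trans (le_trans _ H) _.
  by rewrite le_eqVlt; apply/orP; left; apply/eqP; ring.
by rewrite le_eqVlt; apply/orP; left; apply/eqP; field; rewrite !gt_eqF.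
Qed.

(** This is [ln y <= y - 1] at [y = t / x]. *)
Lemma ln_tangent (R : realType) (x t : R) : (0 < x)%R -> (0 < t)%R ->
  (ln t + 1 <= ln x + t / x)%R.
Proof.
move=> x0 t0; have tx : (0 < t / x)%R by exact: divr_gt0.
have : (ln (1 + (t / x - 1)) <= t / x - 1)%R by apply: le_ln1Dx; lra.
rewrite addrC subrK ln_div ?posrE//; lra.
Qed.

(** * Densities and null sets under absolute continuity *)

Lemma dominates_ae (dT : measure_display) (T : measurableType dT)
    (R : realType) (mu nu : probability T R) (P : T -> Prop) :
  mu `<< nu -> {ae nu, forall z, P z} -> {ae mu, forall z, P z}.
Proof.
move=> /null_content_dominatesP munu [N [mN N0 PN]].
by exists N; split => //; exact: munu.
Qed.

Lemma measurable_lne_EFin (dT : measure_display) (T : measurableType dT)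
    (R : realType) (h : T -> R) : measurable_fun [set: T] h ->
  measurable_fun [set: T] (fun z => lne (h z)%:E).
Proof.
move=> mh; rewrite /=; apply: measurable_fun_ifT => //=.
- exact: measurable_fun_ler.
- by apply/measurable_EFinP; exact: measurableT_comp.
Qed.

(* The library derivative is nonnegative and finite only almost everywhere;
   [k] is a version for which both hold everywhere. *)
Lemma density_versionP (dT : measure_display) (T : measurableType dT)
    (R : realType) (mu nu : probability T R) : mu `<< nu ->
  exists k : T -> R, [/\ measurable_fun [set: T] k,
    forall z, (0 <= k z)%R,
    {ae nu, forall z, density mu nu z = (k z)%:E} &
    forall h : T -> \bar R, (forall z, 0 <= h z) ->
      forall A, measurable A -> measurable_fun A h ->
        \int[mu]_(z in A) h z = \int[nu]_(z in A) (h z * (k z)%:E)].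
Proof.
move=> munu; pose g := Radon_Nikodym_SigmaFinite.f mu nu.
have gk z : (fine (g z))%:E = g z.
  by rewrite fineK// Radon_Nikodym_SigmaFinite.f_fin_num.
have mg : measurable_fun [set: T] g.
  exact: measurable_int (Radon_Nikodym_SigmaFinite.f_integrable munu).
exists (fine \o g); split.
- exact: measurableT_comp.
- by move=> z; apply: fine_ge0; exact: Radon_Nikodym_SigmaFinite.f_ge0.
- have := ae_eq_Radon_Nikodym_SigmaFinite munu (@measurableT _ T).
  by apply: filterS => z /(_ I); rewrite /density => <-; rewrite gk.
- move=> h h0 A mA mh; rewrite -(Radon_Nikodym_SigmaFinite.change_of_variables munu h0 mA mh).
  by apply: eq_integral => z _ /=; rewrite gk.
Qed.

Lemma dominates_fine_gt0 (dT : measure_display) (T : measurableType dT)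
    (R : realType) (mu nu : probability T R) (A : set T) :
  mu `<< nu -> measurable A -> 0 < mu A -> (0 < fine (nu A))%R.
Proof.
move=> /null_content_dominatesP munu mA muA.
rewrite fine_gt0//; apply/andP; split; last by rewrite ltey_eq fin_num_measure.
rewrite lt0e measure_ge0 andbT; apply: contraTN muA => /eqP nuA0.
by rewrite munu// ltxx.
Qed.

Lemma measurable_density (dT : measure_display) (T : measurableType dT)
    (R : realType) (mu nu : probability T R) :
  mu `<< nu -> measurable_fun [set: T] (density mu nu).
Proof.
move=> munu; rewrite /density; apply: (measurable_int nu).
exact: (@Radon_Nikodym_integrable _ _ _ (charge_of_finite_measure mu) nu munu).
Qed.

(** * Jensen's inequality for the p-th root *)

Lemma integral_probability_cst (dT : measure_display) (T : measurableType dT)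
    (R : realType) (P : probability T R) (c : R) : \int[P]_z c%:E = c%:E.
Proof.
have := integral_cst P (@measurableT _ T) c%:E.
by rewrite [X in _ * X](_ : _ = 1) ?mule1//; exact: probability_setT.
Qed.

Lemma powRB1_mulr (R : realType) (t p : R) : (0 < t)%R ->
  (t `^ (p - 1) * t = t `^ p)%R.
Proof.
move=> t0; rewrite -[X in (_ * X)%R]powRr1 ?ltW// -powRD ?subrK//.
by rewrite (lt0r_neq0 t0) implybT.
Qed.

(** Integrate the tangent bound for [G^(1/p)] at a point [t] slightly above the p-th root of the
    integral of [G], then divide by the slope. *)
Lemma integral_root_le (dT : measure_display) (T : measurableType dT)
    (R : realType) (P : probability T R) (G : T -> \bar R) (p : R) :
  (1 <= p)%R -> measurable_fun [set: T] G -> (forall x, 0 <= G x) ->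
  \int[P]_x (G x `^ p^-1) <= (\int[P]_x G x) `^ p^-1.
Proof.
move=> p1 mG G0; have p0 : (0 < p)%R by exact: lt_le_trans p1.
have := integral_ge0 P (fun x (_ : [set: T] x) => G0 x).
case IE : (\int[P]_x G x) => [i| |]// i0; last first.
  by rewrite poweRyr ?invr_neq0 ?gt_eqF// leey.
rewrite lee_fin in i0; apply/lee_addgt0Pr => e e0.
(* Adding [e] keeps the tangent point, and so the slope, positive even when [i = 0]. *)
set t := (i `^ p^-1 + e)%R.
have t0 : (0 < t)%R by rewrite ltr_wpDl// powR_ge0.
have it : (i <= t `^ p)%R.
  rewrite -[leLHS]powRr1// -(mulVf (lt0r_neq0 p0)) powRrM.
  by rewrite ge0_ler_powR ?nnegrE ?powR_ge0 ?ltW// ltrDl.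
have tp : (t `^ p = t * t `^ (p - 1))%R.
  by rewrite mulrC powRB1_mulr.
have c0 : (0 < p * t `^ (p - 1))%R by rewrite mulr_gt0// powR_gt0.
have mGp : measurable_fun [set: T] (fun x => G x `^ p^-1).
  exact: (measurableT_comp (measurable_poweR _)).
have le : (p * t `^ (p - 1))%:E * \int[P]_x (G x `^ p^-1)
    <= i%:E + ((p - 1) * t `^ p)%:E.
  rewrite -ge0_integralZl_EFin//; [|by move=> x _; exact: poweR_ge0|exact: ltW].
  have -> : ((p - 1) * t `^ p)%:E = \int[P]_x ((p - 1) * t `^ p)%:E.
    by rewrite integral_probability_cst.
  have cc0 : (0 <= (p - 1) * t `^ p)%R.
    by rewrite mulr_ge0 ?powR_ge0 ?subr_ge0.
  rewrite -IE -ge0_integralD//.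
  apply: ge0_le_integral => //.
  - by move=> x _; rewrite mule_ge0 ?poweR_ge0// lee_fin ltW.
  - exact: measurable_funeM.
  - exact: emeasurable_funD.
  move=> x _ /=; move: (G0 x); case: (G x) => [g| |]// g0.
    rewrite poweR_EFin -EFinM -EFinD lee_fin.
    apply: le_trans (powR_tangent p1 (powR_ge0 _ _) t0) _.
    by rewrite -powRrM mulVf ?gt_eqF// powRr1.
  by rewrite addye// leey.
(* Since [i <= t^p], the right-hand side is at most [p t^p], which is the slope times [t]. *)
have {}le : (p * t `^ (p - 1))%:E * \int[P]_x (G x `^ p^-1)
    <= (p * t `^ (p - 1))%:E * t%:E.
  apply: le_trans le _; rewrite -EFinD -EFinM lee_fin tp.
  have -> : (p * t `^ (p - 1) * t = t `^ p + (p - 1) * (t * t `^ (p - 1)))%R.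
    by rewrite tp; ring.
  by rewrite lerD2r.
by move: le; rewrite lee_pmul2l.
Qed.

(** * Lower bounds for [nu A] in terms of each divergence *)

Lemma renyi_div_ge (dT : measure_display) (T : measurableType dT)
    (R : realType) (mu nu : probability T R) (A : set T) (alpha : R) :
  (1 < alpha)%R -> mu `<< nu -> measurable A -> (2^-1)%:E <= mu A ->
  (- ln (fine (nu A)))%:E <=
    renyi_div alpha mu nu + (alpha / (alpha - 1) * ln 2)%:E.
Proof.
move=> a1 munu mA muA.
have r0 : (0 < fine (nu A))%R.
  by apply: dominates_fine_gt0 munu mA _; apply: lt_le_trans muA; rewrite lte_fin.
have rE : nu A = (fine (nu A))%:E by rewrite fineK// fin_num_measure.
set r := fine (nu A) in r0 rE *.
have [k [mk k0 dk ck]] := density_versionP munu.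
have a0 : (0 < alpha)%R by lra.
(* If [mu A = 1/2], this is the [nu]-average of [k] over [A], so the tangent bound is then sharp for
   [k] constant on [A]. *)
set t := (2 * r)^-1%R.
have t0 : (0 < t)%R by rewrite invr_gt0 mulr_gt0.
set c := (t `^ (alpha - 1))%R.
have c0 : (0 < c)%R by rewrite powR_gt0.
have ta : (t `^ alpha * r = c / 2)%R.
  have -> : (t `^ alpha = c * t)%R by rewrite powRB1_mulr.
  by rewrite /t; field; rewrite gt_eqF.
have mka : measurable_fun [set: T] (fun z => (k z `^ alpha)%:E).
  by apply/measurable_EFinP; exact: (measurableT_comp (measurable_powR _)).
have -> : renyi_div alpha mu nu =
    ((alpha - 1)^-1)%:E * lne (\int[nu]_z (k z `^ alpha)%:E).
  rewrite /renyi_div; congr (_ * lne _); apply: ae_eq_integral => //.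
    apply: (measurableT_comp (measurable_poweR _)).
    exact: measurable_density.
  by apply: filterS dk => z -> _.
have key : (c / 2)%:E <= \int[nu]_z (k z `^ alpha)%:E.
  apply: (@le_trans _ _ (\int[nu]_(z in A) (k z `^ alpha)%:E)); last first.
    by apply: ge0_subset_integral => // z _; rewrite lee_fin powR_ge0.
  (* The constant term of the tangent is moved to the other side, so that every integrand is
     nonnegative. By [ta], the left-hand side equals [alpha * c / 2], and [mu A >= 1/2] applies. *)
  suff : (c / 2)%:E + ((alpha - 1) * t `^ alpha * r)%:E <=
      \int[nu]_(z in A) (k z `^ alpha)%:E + ((alpha - 1) * t `^ alpha * r)%:E.
    by rewrite leeD2rE.
  apply: (@le_trans _ _ ((alpha * c)%:E * mu A)).
    apply: (@le_trans _ _ ((alpha * c)%:E * (2^-1)%:E)); last first.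
      by rewrite lee_pmul2l// lte_fin mulr_gt0.
    rewrite -EFinD -EFinM lee_fin -mulrA ta.
    by rewrite le_eqVlt; apply/orP; left; apply/eqP; field.
  have cc0 : (0 <= (alpha - 1) * t `^ alpha)%R.
    by rewrite mulr_ge0 ?powR_ge0 ?subr_ge0 ?ltW.
  have ac0 : (0 <= alpha * c)%R by rewrite mulr_ge0 ?ltW.
  rewrite -integral_cst// ck//.
  rewrite [in leRHS]EFinM -rE -integral_cst// -ge0_integralD//=; last 2 first.
  - by move=> z _; rewrite lee_fin powR_ge0.
  - exact: measurable_funTS.
  apply: ge0_le_integral => //.
  - by move=> z _; rewrite mule_ge0 ?lee_fin.
  - by apply: measurable_funTS; apply: measurable_funeM; exact/measurable_EFinP.
  - by apply: emeasurable_funD => //; exact: measurable_funTS.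
  move=> z _; rewrite -EFinM -EFinD lee_fin.
  by apply: powR_tangent => //; exact: ltW.
have {}key : (ln (c / 2))%:E <= lne (\int[nu]_z (k z `^ alpha)%:E).
  have c20 : (0 < c / 2)%R by rewrite divr_gt0.
  rewrite -lne_EFin// lee_lne// in_itv/= leey andbT.
    by rewrite lee_fin ltW.
  by apply: integral_ge0 => z _; rewrite lee_fin powR_ge0.
apply: (@le_trans _ _ (((alpha - 1)^-1)%:E * (ln (c / 2))%:E +
    (alpha / (alpha - 1) * ln 2)%:E)); last first.
  by rewrite leeD2r// lee_wpmul2l// lee_fin invr_ge0 subr_ge0 ltW.
(* As [ln c = - (alpha - 1) (ln 2 + ln r)], dividing [ln (c / 2)] by [alpha - 1] leaves [- ln r]
   minus exactly the added constant. *)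
rewrite -EFinM -EFinD lee_fin ln_div ?posrE// ln_powR lnV ?posrE ?mulr_gt0//.
rewrite lnM ?posrE//.
by rewrite le_eqVlt; apply/orP; left; apply/eqP; field; rewrite subr_eq0 gt_eqF.
Qed.

(** For a weight [t] of [nu]-mass one, integrating [ln t + 1 <= ln k + t / k] against [mu] bounds
    the divergence below by the integral of [ln t], because [t / k] has [mu]-integral at most
    one. *)
Lemma kl_div_ge (dT : measure_display) (T : measurableType dT)
    (R : realType) (mu nu : probability T R) (A : set T) :
  mu `<< nu -> measurable A -> (2^-1)%:E <= mu A ->
  (- ln (fine (nu A)))%:E <= 2%:E * kl_div mu nu + (2 * ln 2)%:E.
Proof.
move=> munu mA muA.
have r0 : (0 < fine (nu A))%R.
  by apply: dominates_fine_gt0 munu mA _; apply: lt_le_trans muA; rewrite lte_fin.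
have rE : nu A = (fine (nu A))%:E by rewrite fineK// fin_num_measure.
have r1 : (fine (nu A) <= 1)%R by rewrite -lee_fin -rE probability_le1.
set r := fine (nu A) in r0 rE r1 *.
have l0 : (0 <= - ln r)%R by rewrite oppr_ge0 ln_le0.
have [k [mk k0 dk ck]] := density_versionP munu.
(* The [mu]-mass of the zero set of [k] is the [nu]-integral of [k] over it. *)
have kgt0 : {ae mu, forall z, (0 < k z)%R}.
  exists (k @^-1` [set 0%R]); split.
  - by rewrite -[X in measurable X]setTI; exact: mk.
  - have mN : measurable (k @^-1` [set 0%R]).
      by rewrite -[X in measurable X]setTI; exact: mk.
    rewrite -[LHS]mul1e -integral_cst// ck//.
    by apply: integral0_eq => z /= ->; rewrite mule0.
  - by move=> z /= /negP; rewrite -leNgt => kz; apply/eqP; rewrite eq_le kz k0.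
have mu_ln : measurable_fun [set: T] (fun z => ln (k z)) by exact: measurableT_comp.
have mdens := measurable_density munu.
have -> : kl_div mu nu = \int[mu]_z (ln (k z))%:E.
  apply: ae_eq_integral => //; last 2 first.
  - exact/measurable_EFinP.
  - apply: filterS2 (dominates_ae munu dk) kgt0 => z -> kz _.
    by rewrite lne_EFin.
  rewrite (_ : (fun z => _) = (fun z => lne (fine (density mu nu z))%:E)).
    by apply: measurable_lne_EFin; exact: measurableT_comp.
  apply/funext => z; rewrite fineK//.
  exact: (@Radon_Nikodym_fin_num _ _ _ (charge_of_finite_measure mu) nu z munu).
(* The positive part of [ln k] may have infinite integral, so the two parts are kept apart until one
   is known to be finite. *)
pose P z := Num.max (ln (k z)) 0%R; pose N z := Num.max (- ln (k z))%R 0%R.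
have mP : measurable_fun [set: T] P by exact: measurable_maxr.
have mN : measurable_fun [set: T] N.
  by apply: measurable_maxr => //; exact: measurableT_comp.
have P0 z : (0 <= P z)%R by rewrite le_max lexx orbT.
have N0 z : (0 <= N z)%R by rewrite le_max lexx orbT.
have PN z : (P z - N z = ln (k z))%R.
  by rewrite /P /N; case: (lerP (ln (k z)) 0); case: (lerP (- ln (k z))%R 0); lra.
have -> : \int[mu]_z (ln (k z))%:E = \int[mu]_z (P z)%:E - \int[mu]_z (N z)%:E.
  rewrite integralE; congr (_ - _); apply: eq_integral => z _.
    by rewrite funeposE -EFin_max.
  by rewrite funenegE -EFinN -EFin_max.
(* This is [t / k], with value 0 where [k] vanishes; there the product with [k] is still at most
   [t]. *)
pose q (t : T -> R) z := (t z * k z `^ (-1))%R.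
have mq t : measurable_fun [set: T] t -> measurable_fun [set: T] (q t).
  move=> mt; apply: measurable_funM => //.
  exact: (measurableT_comp (measurable_powR _)).
have q0 t z : (forall z, 0 <= t z)%R -> (0 <= q t z)%R.
  by move=> t0; rewrite mulr_ge0// powR_ge0.
have int_q (t : T -> R) : measurable_fun [set: T] t -> (forall z, 0 <= t z)%R ->
    \int[mu]_z (q t z)%:E <= \int[nu]_z (t z)%:E.
  move=> mt t0; rewrite ck//; last 2 first.
  - by move=> z; rewrite lee_fin q0.
  - by apply/measurable_EFinP; exact: mq.
  apply: ge0_le_integral => //.
  - by move=> z _; rewrite -EFinM lee_fin mulr_ge0// q0.
  - by apply/measurable_EFinP; apply: measurable_funM => //; exact: mq.
  - exact/measurable_EFinP.
  move=> z _; rewrite -EFinM lee_fin /q powR_inv1//.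
  have := k0 z; rewrite le_eqVlt => /predU1P[<-|kz]; first by rewrite mulr0.
  by rewrite mulfVK ?gt_eqF.
(* The tangent bound at 1 gives [- ln k <= 1 / k - 1], so [N <= 1 / k] almost everywhere. This
   excludes [+oo - +oo] in the divergence. *)
have intN1 : \int[mu]_z (N z)%:E <= 1.
  apply: (@le_trans _ _ (\int[mu]_z (q (cst 1%R) z)%:E)).
    apply: ae_ge0_le_integral => //.
    - by move=> z _; rewrite lee_fin.
    - exact/measurable_EFinP.
    - by move=> z _; rewrite lee_fin q0.
    - by apply/measurable_EFinP; exact: mq.
    apply: filterS kgt0 => z kz _; rewrite lee_fin /q /= powR_inv1//.
    have := ln_tangent kz ltr01; rewrite ln1 add0r mul1r ge_max => H.
    by have := invr_gt0 (k z); rewrite kz => kVz; apply/andP; split; lra.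
  apply: le_trans (int_q _ _ _) _ => //.
  by rewrite integral_probability_cst.
(* The tangent weight is [1/(2r) + 1/2] on [A] and [1/2] off [A]: it has
   [nu]-mass one and its logarithm dominates [1_A log (1/r) - log 2]. *)
pose t z := (2^-1 * r^-1 * \1_A z + 2^-1)%R.
have mt : measurable_fun [set: T] t.
  by apply: measurable_funD => //; apply: measurable_funM.
have t0 z : (0 <= t z)%R.
  by rewrite addr_ge0// mulr_ge0// mulr_ge0// invr_ge0 ltW.
have intt : \int[nu]_z (t z)%:E = 1.
  under eq_integral do rewrite EFinD EFinM.
  rewrite ge0_integralD//; last 2 first.
  - by move=> z _; rewrite -EFinM lee_fin !mulr_ge0// invr_ge0 ltW.
  - apply: measurable_funeM; exact/measurable_EFinP.
  rewrite ge0_integralZl_EFin//; last 2 first.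
  - exact/measurable_EFinP.
  - by rewrite mulr_ge0// invr_ge0 ltW.
  rewrite integral_indic// setIT integral_probability_cst.
  rewrite [X in _ * X + _](_ : _ = r%:E)//.
  rewrite -EFinM -EFinD; congr (_%:E); field.
  by rewrite gt_eqF.
have lnt z : (- ln r * \1_A z - ln 2 <= ln (t z))%R.
  rewrite /t indicE; case: (z \in A); rewrite ?mulr1 ?mulr0 ?add0r.
    rewrite -lnV ?posrE// -ln_div ?posrE ?invr_gt0// mulrC.
    by rewrite ler_ln ?posrE ?addr_gt0 ?mulr_gt0 ?invr_gt0// lerDl.
  by rewrite lnV ?posrE.
(* The integrated tangent inequality, combined with [lnt] and arranged so that both sides are sums
   of nonnegative terms. *)
have NP : \int[mu]_z (N z)%:E + (1 + (- ln r)%:E * mu A) <=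
    \int[mu]_z (P z)%:E + (\int[mu]_z (q t z)%:E + (ln 2)%:E).
  have -> : (- ln r)%:E * mu A = \int[mu]_z ((- ln r)%:E * (\1_A z)%:E).
    rewrite ge0_integralZl_EFin//; last exact/measurable_EFinP.
    by rewrite integral_indic// setIT.
  have ln2 : (0 <= ln 2 :> R)%R by rewrite ln_ge0// ler1n.
  have l1 z : 0 <= (- ln r)%:E * (\1_A z)%:E by rewrite -EFinM lee_fin mulr_ge0.
  have ml1 : measurable_fun [set: T] (fun z => (- ln r)%:E * (\1_A z)%:E).
    by apply: measurable_funeM; exact/measurable_EFinP.
  have l10 z : 0 <= 1 + (- ln r)%:E * (\1_A z)%:E by exact: adde_ge0.
  have q20 z : 0 <= (q t z)%:E + (ln 2)%:E by rewrite lee_fin addr_ge0// q0.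
  have mqt : measurable_fun [set: T] (fun z => (q t z)%:E).
    by apply/measurable_EFinP; exact: mq.
  have mPE : measurable_fun [set: T] (fun z => (P z)%:E) by exact/measurable_EFinP.
  have mNE : measurable_fun [set: T] (fun z => (N z)%:E) by exact/measurable_EFinP.
  have ml10 : measurable_fun [set: T] (fun z => 1 + (- ln r)%:E * (\1_A z)%:E).
    exact: emeasurable_funD.
  have mq2 : measurable_fun [set: T] (fun z => (q t z)%:E + (ln 2)%:E).
    exact: emeasurable_funD.
  rewrite -(integral_probability_cst mu 1%R) -(integral_probability_cst mu (ln 2)).
  rewrite -!ge0_integralD//; [|by move=> z _; rewrite lee_fin ?q0 ?P0 ?N0..].
  apply: ae_ge0_le_integral => //.
  - by move=> z _; apply: adde_ge0 (l10 z); rewrite lee_fin.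
  - exact: emeasurable_funD.
  - by move=> z _; apply: adde_ge0 (q20 z); rewrite lee_fin.
  - exact: emeasurable_funD.
  apply: filterS kgt0 => z kz _.
  rewrite -EFinM -!EFinD lee_fin /q powR_inv1//.
  have tz : (0 < t z)%R.
    by rewrite ltr_wpDl// mulr_ge0// mulr_ge0// invr_ge0 ltW.
  have := ln_tangent kz tz; have := lnt z; have := PN z; lra.
have Tle := int_q t mt t0; rewrite intt in Tle.
have T0 : 0 <= \int[mu]_z (q t z)%:E.
  by apply: integral_ge0 => z _; rewrite lee_fin q0.
have IP0 : 0 <= \int[mu]_z (P z)%:E.
  by apply: integral_ge0 => z _; rewrite lee_fin.
have IN0 : 0 <= \int[mu]_z (N z)%:E.
  by apply: integral_ge0 => z _; rewrite lee_fin.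
have mAE : mu A = (fine (mu A))%:E by rewrite fineK// fin_num_measure.
rewrite mAE lee_fin in muA; rewrite mAE in NP.
move: NP Tle T0 IP0 IN0 intN1.
case: (\int[mu]_z (q t z)%:E) => [s| |]//.
case: (\int[mu]_z (N z)%:E) => [n| |]//.
case: (\int[mu]_z (P z)%:E) => [p| |]//; last first.
  by move=> *; rewrite addye// gt0_muley ?lte_fin// addye// leey.
rewrite -EFinN -!EFinM -!EFinD !lee_fin.
move=> le s1 s0 p0 n0 n1.
(* Replacing [mu A] by 1/2 uses [- ln r >= 0]. What results is half of the claim. *)
have : (2^-1 * - ln r <= - ln r * fine (mu A))%R by rewrite mulrC ler_wpM2l.
lra.
Qed.

(** * From one median to the expected supremum *)

Lemma median_le (dT : measure_display) (T : measurableType dT)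
    (R : realType) (mu nu : probability T R) (W : T -> R) (m p alpha : R) :
  (1 < alpha)%R -> (1 <= p)%R -> mu `<< nu -> measurable_fun [set: T] W ->
  (2^-1)%:E <= mu [set z | (m <= W z)%R] ->
  m%:E <= (\int[nu]_z (Num.max (W z) 0 `^ p)%:E) `^ p^-1 *
    expeR (renyi_kl_bound alpha mu nu * (p^-1)%:E).
Proof.
move=> a1 p1 munu mW muW; have p0 : (0 < p)%R by exact: lt_le_trans p1.
have [m0|m0] := leP m 0%R.
  by apply: (@le_trans _ _ 0); rewrite ?lee_fin// mule_ge0 ?poweR_ge0 ?expeR_ge0.
set A := [set z | (m <= W z)%R] in muW *.
have mA : measurable A.
  rewrite -[X in measurable X]setTI.
  by apply: (measurable_fun_ler (measurable_cst m) mW) => //.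
have r0 : (0 < fine (nu A))%R.
  by apply: dominates_fine_gt0 munu mA _; apply: lt_le_trans muW; rewrite lte_fin.
have bound_ge : (- ln (fine (nu A)))%:E <= renyi_kl_bound alpha mu nu.
  by rewrite le_min renyi_div_ge// kl_div_ge.
have rE : nu A = (fine (nu A))%:E by rewrite fineK// fin_num_measure.
set r := fine (nu A) in r0 bound_ge rE.
have mWp : measurable_fun [set: T] (fun z => (Num.max (W z) 0 `^ p)%:E).
  apply/measurable_EFinP; apply: (measurableT_comp (measurable_powR _)) => //.
  exact: measurable_maxr.
have markov : (m `^ p * r)%:E <= \int[nu]_z (Num.max (W z) 0 `^ p)%:E.
  rewrite EFinM -rE -integral_cst//.
  apply: (@le_trans _ _ (\int[nu]_(z in A) (Num.max (W z) 0 `^ p)%:E)).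
    apply: ge0_le_integral => //.
    - by move=> z _; rewrite lee_fin powR_ge0.
    - exact: measurable_funTS.
    move=> z Az; rewrite lee_fin ge0_ler_powR ?nnegrE ?(ltW p0) ?(ltW m0)//.
      by rewrite le_max lexx orbT.
    by rewrite le_max Az.
  by apply: ge0_subset_integral => // z _; rewrite lee_fin powR_ge0.
(* Writing [m] as a product lets Markov's inequality bound the first factor and the divergence
   estimate the second. *)
have mE : ((m `^ p * r) `^ p^-1 * expR (- ln r * p^-1) = m)%R.
  rewrite powRM ?powR_ge0 ?ltW// -powRrM mulfV ?gt_eqF// powRr1 ?ltW//.
  rewrite {1}/powR gt_eqF// -mulrA -expRD mulNr (mulrC (ln r)) subrr.
  by rewrite expR0 mulr1.
rewrite -[X in X%:E]mE EFinM; apply: lee_pmul.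
- by rewrite lee_fin powR_ge0.
- by rewrite lee_fin expR_ge0.
- rewrite -poweR_EFin gt0_ler_poweR ?invr_ge0 ?(ltW p0)// in_itv/= leey andbT.
    by rewrite lee_fin mulr_ge0 ?powR_ge0 ?ltW.
  by apply: integral_ge0 => z _; rewrite lee_fin powR_ge0.
rewrite -[(expR _)%:E]/(expeR (- ln r * p^-1)%:E) lee_expeR EFinM.
by rewrite lee_wpmul2r// lee_fin invr_ge0 ltW.
Qed.

Theorem corollary2 (R : realType) (d : nat)
    (dZ : measure_display) (Z : measurableType dZ)
    (muX : probability (euclidean R d) R)
    (M : set (probability Z R))
    (f : euclidean R d * Z -> R)
    (f_meas : measurable_fun [set: euclidean R d * Z] f)
    (f_Lp : forall mu : probability Z R, M mu ->
       exists2 p : R, (1 <= p)%R &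
         'N[muX \x mu]_(p%:E)[EFin \o f] < +oo)
    (F : probability Z R -> euclidean R d -> R)
    (F_median : forall mu : probability Z R, M mu ->
       forall x : euclidean R d, is_median mu (fun z => f (x, z)) (F mu x))
    (F_meas : forall mu : probability Z R, M mu ->
       measurable_fun [set: euclidean R d] (F mu))
    (muref : probability Z R) (muref_M : M muref)
    (sup_meas : measurable_fun [set: euclidean R d]
       (fun x => ereal_sup [set (F mu x)%:E | mu in
                              [set mu | M mu /\ mu `<< muref]] : \bar R))
    (alpha : R) (alpha_gt1 : (1 < alpha)%R) :
  \int[muX]_x ereal_sup [set (F mu x)%:E | mu in
                           [set mu | M mu /\ mu `<< muref]]
  <= ereal_inf
       [set mul_infty
              ((\int[muX \x muref]_w ((Num.max (f w) 0 `^ p)%R)%:E) `^ p^-1)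
              (ereal_sup
                 [set expeR (renyi_kl_bound alpha mu muref * (p^-1)%:E) | mu in
                    [set mu | M mu /\ mu `<< muref]])
        | p in [set p : R | (1 <= p)%R]].
Proof.
apply: le_ereal_inf_tmp => _ [p /= p1 <-].
have p0 : (0 < p)%R by exact: lt_le_trans p1.
set S := ereal_sup [set expeR _ | mu in _].
set I := \int[muX \x muref]_w _.
(* An infinite factor makes the bound trivial. Otherwise the product is the ordinary one and [S] is
   finite. *)
rewrite /mul_infty; case: ifPn => [_|]; first by rewrite leey.
rewrite negb_or => /andP[_ Sy].
(* The family contains [muref] itself, so the supremum is not over the empty set. *)
have S0 : 0 <= S.
  apply: le_trans (ereal_sup_ubound _); last by exists muref; split.
  exact: expeR_ge0.
have Sfin : S = (fine S)%:E by rewrite fineK// ge0_fin_numE// lt_neqAle Sy leey.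
pose g w := (Num.max (f w) 0 `^ p)%:E.
have mg : measurable_fun [set: euclidean R d * Z] g.
  apply/measurable_EFinP; apply: (measurableT_comp (measurable_powR _)) => //.
  exact: measurable_maxr.
have g0 w : 0 <= g w by rewrite lee_fin powR_ge0.
pose G := fubini_F muref g.
have mG : measurable_fun [set: euclidean R d] G.
  exact: measurable_fun_fubini_tonelli_F.
have G0 x : 0 <= G x by apply: integral_ge0.
have IE : I = \int[muX]_x G x by rewrite /I fubini_tonelli1.
have mGp : measurable_fun [set: euclidean R d] (fun x => G x `^ p^-1).
  exact: (measurableT_comp (measurable_poweR _)).
have sup_le x : ereal_sup [set (F mu x)%:E | mu in
    [set mu | M mu /\ mu `<< muref]] <= S * G x `^ p^-1.
  apply: ge_ereal_sup => _ [mu /= [Mmu mumuref] <-].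
  have mfx : measurable_fun [set: Z] (fun z => f (x, z)).
    exact: measurableT_comp.
  have [medx _] := F_median mu Mmu x.
  apply: le_trans (median_le alpha_gt1 p1 mumuref mfx medx) _.
  rewrite muleC; apply: lee_wpmul2r; first exact: poweR_ge0.
  by apply: ereal_sup_ubound; exists mu.
(* The supremum may change sign. Its negative part is dropped, and its positive part obeys the same
   pointwise bound because that bound is nonnegative. *)
rewrite integralE.
apply: (@le_trans _ _ (\int[muX]_x (S * G x `^ p^-1))).
  apply: (@le_trans _ _ (\int[muX]_x ((fun x => ereal_sup [set (F mu x)%:E | mu in
      [set mu | M mu /\ mu `<< muref]])^\+ x))).
    rewrite geeDl// oppe_le0; apply: integral_ge0 => x _; exact: funeneg_ge0.
  apply: ge0_le_integral => //.
  - exact: measurable_funepos.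
  - by rewrite Sfin; exact: measurable_funeM.
  move=> x _; rewrite funeposE ge_max sup_le/=.
  by rewrite mule_ge0// poweR_ge0.
rewrite Sfin ge0_integralZl_EFin//; last 2 first.
- by move=> x _; exact: poweR_ge0.
- by rewrite fine_ge0.
(* Jensen's inequality for [muX] moves the root outside, and Tonelli, in the form [IE], identifies
   the remaining integral. *)
by rewrite muleC lee_wpmul2r// ?IE ?integral_root_le// -Sfin.
Qed.
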